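(* For every integer $n\ge 0$, the mapping $\Phi=\Psi^{-1}\circ\rho\circ\Psi$ is an involution on the set $\mathcal{F}_n$ of pointed partitions of $n$ such that, if $\Phi:(\lambda,v)\mapsto(\mu,u)$, then $$(a_v(\lambda),\,l_v(\lambda),\,m_v(\lambda))=(a_u(\mu),\,m_u(\mu),\,l_u(\mu)).$$ In particular, $\Phi$ also satisfies $$(h_v(\lambda),\,p_v(\lambda))=(p_u(\mu),\,h_u(\mu)).$$
   Context: Partitions. A partition is a finite (possibly empty) weakly decreasing sequence $\lambda=(\lambda_1\ge\cdots\ge\lambda_\ell>0)$ of positive integers; $|\lambda|$ is the sum of its parts, $\lambda'$ its conjugate. It is identified with its Ferrers diagram, drawn with $\lambda_1$ as the bottom row (rows are left-justified and numbered from bottom to top). ''Fits inside an $r\times c$ rectangle'' means at most $r$ parts, each at most $c$; ''is an $r\times c$ rectangle'' means $r$ parts, each equal to $c$ (empty if $r=0$ or $c=0$). Pointed partitions. A pointed partition of $n$ is a pair $(\lambda,v)$ with $\lambda$ a partition of $n$ and $v$ a cell of its Ferrers diagram; $\mathcal{F}_n$ is the set of these. For $(\lambda,v)$, let the arm length $a_v$, leg length $l_v$, coarm length $m_v$, coleg length $g_v$ be, respectively, the number of cells in the same row as $v$ strictly to its right, in the same column strictly above it, in the same row strictly to its left, in the same column strictly below it. The hook length is $h_v=l_v+a_v+1$ and the part length is $p_v=m_v+a_v+1$. Let $\mathcal{F}_n(a,l,m)$ be the set of $(\lambda,v)\in\mathcal{F}_n$ with $a_v=a$, $l_v=l$, $m_v=m$.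 Step 1 (decomposition). For $(\lambda,v)\in\mathcal{F}_n(a,l,m)$ with $v$ in row $g+1$ (where $g=g_v$), set $\varphi_{a,l,m}(\lambda,v)=(A,B,C,D,E)$, where $C=(\lambda_1,\ldots,\lambda_g)$ (all parts $\ge m+a+1$); $D$ is the $(l+1)\times(m+1)$ rectangle formed by the cells in rows $g+1,\ldots,g+l+1$ and columns $1,\ldots,m+1$; $E$ is the $1\times a$ rectangle formed by the cells to the right of $v$ in its row; $B=(\lambda_{g+2}-m-1,\ldots,\lambda_{g+l+1}-m-1)$ with zeros deleted (fits inside an $l\times a$ rectangle); $A=(\lambda_{g+l+2},\lambda_{g+l+3},\ldots)$ (largest part at most $m$). Pealing algorithm with parameter $a$, applied to a partition $A$ with largest part at most $m$: as long as the current partition $(\lambda_1,\ldots,\lambda_\ell)$ has $\ell\ge a+1$ parts, remove the rim hook (connected border strip) of height $a+1$ starting at the leftmost cell of the top row and ending at the rightmost cell of row $\ell-a$; it has $\lambda_{\ell-a}+a$ cells, and the remaining partition is $(\lambda_1,\ldots,\lambda_{\ell-a-1},\lambda_{\ell-a+1}-1,\ldots,\lambda_\ell-1)$ with zeros deleted. Let $\tilde{A}$ be the final remaining partition and $r_1,\ldots,r_t$ ($t\ge0$) the lengths (numbers of cells) of the removed rim hooks in order of removal; one has $a+1\le r_1\le\cdots\le r_t\le a+m$. Step 2. Let $\psi_{a,l,m}(A,B,C,D,E)=(\tilde{A},B,\tilde{C},D,E)$, where $(\tilde{A};r_1,\ldots,r_t)$ is the result of the pealing algorithm with parameter $a$ applied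 to $A$, and $\tilde{C}=(C,r_t,r_{t-1},\ldots,r_1)$ is the partition obtained by appending $r_t,\ldots,r_1$ to the parts of $C$. Let $\widetilde{\mathcal{Q}}_n(a,l,m)$ be the set of quintuples $(\tilde{A},B,\tilde{C},D,E)$ of partitions such that $\tilde{A}$ fits inside an $a\times m$ rectangle, $B$ fits inside an $l\times a$ rectangle, all parts of $\tilde{C}$ are at least $a+1$, $D$ is an $(l+1)\times(m+1)$ rectangle, $E$ is a $1\times a$ rectangle, and $|\tilde{A}|+|B|+|\tilde{C}|+|D|+|E|=n$. Let $\widetilde{\mathcal{Q}}_n$ be the disjoint union of the $\widetilde{\mathcal{Q}}_n(a,l,m)$ over all $a,l,m\ge0$. The (bijective) map $\Psi:\mathcal{F}_n\to\widetilde{\mathcal{Q}}_n$ is defined by $\Psi(\lambda,v)=\psi_{a,l,m}(\varphi_{a,l,m}(\lambda,v))$ for $(\lambda,v)\in\mathcal{F}_n(a,l,m)$. Step 3. The involution $\rho$ on $\widetilde{\mathcal{Q}}_n$ is $\rho(\tilde{A},B,\tilde{C},D,E)=(B',\tilde{A}',\tilde{C},D',E)$, which maps $\widetilde{\mathcal{Q}}_n(a,l,m)$ to $\widetilde{\mathcal{Q}}_n(a,m,l)$. *)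

(* Defs.v *)
From mathcomp Require Import all_boot.

Set Implicit Arguments.
Unset Strict Implicit.
Unset Printing Implicit Defensive.

Definition is_part (s : seq nat) : bool := sorted geq s && (0 \notin s).

Definition conj_part (s : seq nat) : seq nat :=
  mkseq (fun j => count (ltn j) s) (head 0 s).

Definition del0 (s : seq nat) : seq nat := [seq p <- s | 0 < p].

Definition fits (r c : nat) (s : seq nat) : bool :=
  (size s <= r) && all (fun p => p <= c) s.

Definition rect (r c : nat) : seq nat := if c is 0 then [::] else nseq r c.

(* Rows and columns are numbered from 0: the cell (i, j) is the one in row
   i + 1 (from the bottom) and column j + 1 (from the left), so that the row
   of (i, j) has nth 0 s i cells. *)
Definition cells (s : seq nat) : seq (nat * nat) :=
  [seq (i, j) | i <- iota 0 (size s), j <- iota 0 (nth 0 s i)].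

Definition pointed : Type := (seq nat * (nat * nat))%type.

Definition arm (s : seq nat) (v : nat * nat) : nat :=
  count (fun c => (c.1 == v.1) && (v.2 < c.2)) (cells s).
Definition leg (s : seq nat) (v : nat * nat) : nat :=
  count (fun c => (c.2 == v.2) && (v.1 < c.1)) (cells s).
Definition coarm (s : seq nat) (v : nat * nat) : nat :=
  count (fun c => (c.1 == v.1) && (c.2 < v.2)) (cells s).
Definition coleg (s : seq nat) (v : nat * nat) : nat :=
  count (fun c => (c.2 == v.2) && (c.1 < v.1)) (cells s).
Definition hook (s : seq nat) (v : nat * nat) : nat := leg s v + arm s v + 1.
Definition part_length (s : seq nat) (v : nat * nat) : nat :=
  coarm s v + arm s v + 1.

Definition F (n : nat) : pred pointed :=
  fun x => [&& is_part x.1, sumn x.1 == n & x.2 \in cells x.1].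

(* (A, B, C, D, E) *)
Definition quintuple : Type :=
  (seq nat * seq nat * seq nat * seq nat * seq nat)%type.

Definition phi (a l m : nat) (x : pointed) : quintuple :=
  let: (s, v) := x in
  let g := coleg s v in
  (drop (g + l + 1) s,
   del0 [seq p - m.+1 | p <- take l (drop g.+1 s)],
   take g s,
   rect l.+1 m.+1,
   rect 1 a).

(* One step of the pealing algorithm on a partition with at least a + 1 parts:
   the length of the removed rim hook of height a + 1, and what remains. *)
Definition rim_hook_length (a : nat) (s : seq nat) : nat :=
  nth 0 s (size s - a.+1) + a.

Definition peal_step (a : nat) (s : seq nat) : seq nat :=
  take (size s - a.+1) s ++ del0 [seq p.-1 | p <- drop (size s - a) s].

(* k bounds the number of steps; each step loses at least one part, so that
   k = size s is enough (see pealE). *)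
Fixpoint peal_rec (k a : nat) (s : seq nat) : seq nat * seq nat :=
  if k is k'.+1 then
    if a < size s then
      let: (s', r) := peal_rec k' a (peal_step a s) in
      (s', rim_hook_length a s :: r)
    else (s, [::])
  else (s, [::]).

Definition peal (a : nat) (s : seq nat) : seq nat * seq nat :=
  peal_rec (size s) a s.

Lemma size_peal_step a s : a < size s -> size (peal_step a s) < size s.
Proof.
move=> lt_as; rewrite /peal_step size_cat size_takel ?leq_subr //.
apply: (@leq_ltn_trans (size s - a.+1 + a)); last first.
  by rewrite -addnS subnK.
rewrite leq_add2l size_filter (leq_trans (count_size _ _)) //.
by rewrite size_map size_drop subKn // ltnW.
Qed.

Lemma peal_rec_fuel k k' a s :
  size s <= k -> size s <= k' -> peal_rec k a s = peal_rec k' a s.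
Proof.
elim: k k' s => [|k IHk] [|k'] s //=.
- by rewrite leqn0 => /eqP->.
- by move=> _; rewrite leqn0 => /eqP->.
move=> sk sk'; case: ifP => // /size_peal_step lt_s.
by rewrite (IHk k') // -ltnS (leq_trans lt_s).
Qed.

Lemma pealE a s :
  peal a s =
    if a < size s then
      let: (s', r) := peal a (peal_step a s) in (s', rim_hook_length a s :: r)
    else (s, [::]).
Proof.
rewrite {1}/peal; case Ds: (size s) => [|k] //=; rewrite Ds.
case: ifP => // lt_as; have := @size_peal_step a s; rewrite Ds => /(_ lt_as).
by rewrite ltnS => le_k; rewrite /peal (@peal_rec_fuel k (size (peal_step a s))).
Qed.

Definition psi (a : nat) (q : quintuple) : quintuple :=
  let: (A, B, C, D, E) := q in
  let: (At, r) := peal a A in (At, B, C ++ rev r, D, E).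

Definition Qtilde_alm (n a l m : nat) : pred quintuple :=
  fun q => let: (A, B, C, D, E) := q in
  [&& [&& is_part A, is_part B & is_part C],
      fits a m A, fits l a B, all (fun p => a.+1 <= p) C,
      D == rect l.+1 m.+1, E == rect 1 a
    & sumn A + sumn B + sumn C + sumn D + sumn E == n].

(* The tag (a, l, m) makes the union over a, l, m disjoint. *)
Definition tagged_quintuple : Type := (nat * nat * nat * quintuple)%type.

Definition Qtilde (n : nat) : pred tagged_quintuple :=
  fun y => let: (a, l, m, q) := y in Qtilde_alm n a l m q.

Definition Psi (x : pointed) : tagged_quintuple :=
  let a := arm x.1 x.2 in
  let l := leg x.1 x.2 in
  let m := coarm x.1 x.2 in
  (a, l, m, psi a (phi a l m x)).

Definition rho (y : tagged_quintuple) : tagged_quintuple :=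
  let: (a, l, m, (A, B, C, D, E)) := y in
  (a, m, l, (conj_part B, conj_part A, C, conj_part D, E)).

(* Main.v *)
Require Import Defs.
From mathcomp Require Import all_boot zify.

Set Implicit Arguments.
Unset Strict Implicit.
Unset Printing Implicit Defensive.

(** The two maps composing [Psi] are both invertible, for elementary reasons.

    The first one cuts the diagram of a pointed partition along the row and
    the column of its cell, and nothing is lost: given the arm [a], the leg
    [l] and the coarm [m], [assemble] glues the pieces back, and its result has
    exactly these statistics ([assemble_stats], [phi_assemble],
    [phi_decomposed]).

    The second one peals rim hooks. Removing a rim hook of height [a + 1]
    deletes one part [p] and subtracts 1 from the last [a] parts. These were at
    most [p], so they end up below [p], while the parts preceding [p] are at
    least [p]. Hence the hook length [p + a] and the remaining partition
    determine what was removed: keep the parts that are at least [p], insert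
    [p], add 1 to the parts below [p] after padding them with zeros to [a]
    parts ([unpeal_step]). This makes sense as soon as at most [a] parts are
    below [p], and the successive insertions of a sequence of lengths preserve
    this condition exactly when the lengths are inserted in weakly decreasing
    order ([count_unpeal], [rim_hook_length_ge]). So pealing is a bijection
    from the partitions with parts at most [m] to the pairs made of a partition
    in an [a] by [m] box and a multiset of lengths between [a + 1] and [a + m]
    ([unpealK], [pealK]).

    The parts of the remaining component [C] of a decomposition exceed
    [a + m], so that comparison with [a + m] separates them from the lengths
    of the hooks after both have been merged into one partition. This gives
    the inverse [Psi_inverse] of [Psi]. Conjugation being an involution that
    preserves size and exchanges the sides of boxes, [rho] is an involution
    exchanging the tags [l] and [m], and so does its conjugate [Phi] with the
    leg and the coarm. *)

(** * Partitions as sequences *)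

Lemma geq_trans : transitive geq.
Proof. by move=> y x z /= yx zy; apply: leq_trans zy yx. Qed.

Lemma is_part_pairwise s : is_part s = pairwise geq s && all (ltn 0) s.
Proof.
rewrite /is_part (sorted_pairwise geq_trans); congr (_ && _).
by elim: s => //= x s <-; rewrite inE negb_or eq_sym lt0n.
Qed.

Lemma is_part_cat s1 s2 :
  is_part (s1 ++ s2) = [&& allrel geq s1 s2, is_part s1 & is_part s2].
Proof.
rewrite !is_part_pairwise pairwise_cat all_cat.
by case: allrel; case: (pairwise _ s1); case: (pairwise _ s2); case: (all _ s1).
Qed.

Lemma is_part_filter (P : pred nat) s : is_part s -> is_part (filter P s).
Proof.
case/andP=> s_sorted s0; rewrite /is_part sorted_filter //=.
  by rewrite mem_filter negb_and s0 orbT.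
exact: geq_trans.
Qed.

Lemma del0_sorted s : sorted geq s -> is_part (del0 s).
Proof.
move=> s_sorted; rewrite /is_part sorted_filter //=; last exact: geq_trans.
by rewrite mem_filter.
Qed.

Lemma allrel_geq c s1 s2 :
  all (leq c) s1 -> all (geq c) s2 -> allrel geq s1 s2.
Proof.
move=> /allP s1P /allP s2P; apply/allrelP=> x y /s1P cx /s2P /= yc.
exact: leq_trans yc cx.
Qed.

Lemma filter_none (P : pred nat) s :
  {in s, forall p, ~~ P p} -> [seq p <- s | P p] = [::].
Proof.
by move=> notP; apply/eqP; rewrite -[_ == _]negbK -has_filter; apply/hasPn.
Qed.

Lemma filter_split j s : sorted geq s ->
  [seq p <- s | j < p] ++ [seq p <- s | p <= j] = s.
Proof.
elim: s => //= x s IHs xs; have [xj|jx] := leqP x j; last first.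
  by rewrite /= IHs // (path_sorted xs).
have /allP sx : all (geq x) s by apply: order_path_min xs; exact: geq_trans.
have small p : p \in s -> p <= j by move/sx/leq_trans; apply.
rewrite (_ : [seq p <- s | j < p] = [::]) /=; last first.
  by apply: filter_none => p /small; rewrite -leqNgt.
by congr cons; apply/all_filterP/allP.
Qed.

Lemma take_count j s : sorted geq s ->
  take (count (ltn j) s) s = [seq p <- s | j < p].
Proof.
by move=> /(filter_split j) {2}<-; rewrite -size_filter take_size_cat.
Qed.

Lemma drop_count j s : sorted geq s ->
  drop (count (ltn j) s) s = [seq p <- s | p <= j].
Proof.
by move=> /(filter_split j) {2}<-; rewrite -size_filter drop_size_cat.
Qed.

(** Both sides say that the cell in row [i] and column [j] belongs to the
    diagram, read off the length of its column and the length of its row. *)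
Lemma ltn_count_nth j i s : sorted geq s ->
  (i < count (ltn j) s) = (j < nth 0 s i).
Proof.
move=> s_sorted; rewrite -{2}(filter_split j s_sorted) nth_cat size_filter.
case: ifP => [lt_i|_].
  have : nth 0 [seq p <- s | j < p] i \in [seq p <- s | j < p].
    by rewrite mem_nth // size_filter.
  by rewrite mem_filter => /andP[->].
set t := [seq p <- s | p <= j]; set k := i - _.
case: (ltnP k (size t)) => [kt|tk]; last by rewrite nth_default.
by have := mem_nth 0 kt; rewrite {1}mem_filter leqNgt; case: (_ < _).
Qed.

(** * Conjugation *)

Lemma nth_conj_part s j : sorted geq s ->
  nth 0 (conj_part s) j = count (ltn j) s.
Proof.
move=> s_sorted; rewrite /conj_part.
have [jh|hj] := ltnP j (head 0 s); first by rewrite nth_mkseq.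
rewrite nth_default ?size_mkseq //; apply/esym/eqP.
by rewrite -leqn0 leqNgt ltn_count_nth // nth0 -leqNgt.
Qed.

Lemma size_conj_part s : size (conj_part s) = head 0 s.
Proof. by rewrite size_mkseq. Qed.

Lemma conj_part_is_part s : is_part s -> is_part (conj_part s).
Proof.
case/andP=> s_sorted _; apply/andP; split.
  apply/(sortedP 0) => i _; rewrite !nth_conj_part //=.
  by apply: sub_count => p /=; apply: leq_trans.
apply/mapP=> -[j]; rewrite mem_iota /= add0n => jh /esym/eqP.
by rewrite -leqn0 leqNgt ltn_count_nth // nth0 jh.
Qed.

Lemma count_ltn_iota k n : count (ltn^~ k) (iota 0 n) = minn k n.
Proof.
elim: n => [|n IHn]; first by rewrite minn0.
by rewrite -(addn1 n) iotaD count_cat IHn /= add0n addn0; lia.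
Qed.

Lemma count_conj_part s i : sorted geq s ->
  count (ltn i) (conj_part s) = nth 0 s i.
Proof.
move=> s_sorted; rewrite count_map.
rewrite (eq_count (a2 := ltn^~ (nth 0 s i))); last first.
  by move=> j /=; rewrite ltn_count_nth.
rewrite count_ltn_iota; apply/minn_idPl.
case: s s_sorted => [|x s] /=; first by rewrite nth_nil.
move/(order_path_min geq_trans)/allP=> s_le_x.
case: i => //= i; case: (ltnP i (size s)) => [lt_i|le_i].
  exact/s_le_x/mem_nth.
by rewrite nth_default.
Qed.

Lemma conj_partK s : is_part s -> conj_part (conj_part s) = s.
Proof.
move=> s_part; have /andP[s_sorted _] := s_part.
have /andP[c_sorted _] := conj_part_is_part s_part.
have size_s : size (conj_part (conj_part s)) = size s.
  rewrite size_conj_part -nth0 nth_conj_part //; apply/eqP.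
  by rewrite -all_count; move: s_part; rewrite is_part_pairwise => /andP[].
apply: (eq_from_nth (x0 := 0)) => // i _.
by rewrite nth_conj_part // count_conj_part.
Qed.

(** Double counting: part [p] contributes one to each of the first [p]
    columns. *)
Lemma sumn_conj_part s : sorted geq s -> sumn (conj_part s) = sumn s.
Proof.
move=> s_sorted; have head_max p : p \in s -> p <= head 0 s.
  case: s s_sorted => //= x s /(order_path_min geq_trans)/allP s_le_x.
  by rewrite inE => /predU1P[->|/s_le_x].
rewrite !sumnE big_map; under eq_bigr => j _ do rewrite -sum1_count big_mkcond.
rewrite exchange_big [RHS]big_seq big_seq; apply: eq_bigr => p /head_max ph.
rewrite -big_mkcond /= sum1_count count_ltn_iota; exact/minn_idPl.
Qed.

Lemma fits_conj_part r c s : sorted geq s -> fits r c s -> fits c r (conj_part s).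
Proof.
move=> s_sorted /andP[size_s /allP s_le]; rewrite /fits size_conj_part.
apply/andP; split.
  by case: s s_le {size_s s_sorted} => //= x s s_le; apply: s_le; rewrite inE eqxx.
by apply/allP => _ /mapP[j _ ->]; apply: leq_trans (count_size _ _) size_s.
Qed.

Lemma conj_rect r c : conj_part (rect r.+1 c.+1) = rect c.+1 r.+1.
Proof.
apply: (eq_from_nth (x0 := 0)) => [|j].
  by rewrite size_conj_part size_nseq.
rewrite size_conj_part /= => jc.
by rewrite nth_mkseq // (nth_nseq _ c.+1) jc (count_nseq _ r.+1) /= jc mul1n.
Qed.

(** * Padding with zeros *)

(** Deleting zeros forgets the number of rows of a box; padding restores it. *)
Definition pad k s := s ++ nseq (k - size s) 0.

Lemma size_pad k s : size s <= k -> size (pad k s) = k.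
Proof. by move=> sk; rewrite size_cat size_nseq subnKC. Qed.

Lemma del0_pad k s : is_part s -> del0 (pad k s) = s.
Proof.
rewrite is_part_pairwise => /andP[_ s_pos].
rewrite /del0 filter_cat (all_filterP s_pos) -[RHS]cats0; congr cat.
by elim: (k - _).
Qed.

Lemma pad_del0 s : sorted geq s -> pad (size s) (del0 s) = s.
Proof.
move=> /(filter_split 0) s_split; rewrite /pad -[RHS]s_split; congr cat.
have -> : size s - size (del0 s) = size [seq p <- s | p <= 0].
  by rewrite -[s in size s - _]s_split size_cat addKn.
by elim: s {s_split} => //= -[|x] s IHs /=; rewrite ?IHs.
Qed.

Lemma sorted_pad k s : is_part s -> sorted geq (pad k s).
Proof.
rewrite is_part_pairwise => /andP[s_pw _].
rewrite (sorted_pairwise geq_trans) pairwise_cat s_pw andTb; apply/andP; split.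
  by apply: (@allrel_geq 0); [apply/allP | rewrite all_nseq orbT].
by elim: (k - _) => //= k' ->; rewrite andbT; rewrite all_nseq /= orbT.
Qed.

Lemma sumn_pad k s : sumn (pad k s) = sumn s.
Proof. by rewrite sumn_cat sumn_nseq addn0. Qed.

Lemma all_pad (P : pred nat) k s : P 0 -> all P (pad k s) = all P s.
Proof. by move=> P0; rewrite all_cat all_nseq P0 orbT andbT. Qed.

Lemma sumn_map_addn c s : sumn (map (addn c) s) = size s * c + sumn s.
Proof. by elim: s => //= p s ->; rewrite mulSn; lia. Qed.

Lemma map_subn_addnK c s : all (leq c) s -> map (addn c) (map (subn^~ c) s) = s.
Proof.
move=> /allP s_ge; rewrite -map_comp map_id_in // => p /s_ge /= cp.
exact: subnKC.
Qed.

Lemma map_addn_subnK c s : map (subn^~ c) (map (addn c) s) = s.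
Proof. by rewrite -map_comp map_id_in // => p _ /=; rewrite addKn. Qed.

Lemma sorted_map_addn c s : sorted geq (map (addn c) s) = sorted geq s.
Proof.
by case: s => //= x s; elim: s x => //= y s IHs x; rewrite IHs leq_add2l.
Qed.

(** * Arm, leg, coarm and coleg *)

Lemma count_iota_eq i n : count (pred1 i) (iota 0 n) = (i < n).
Proof.
elim: n => // n IHn; rewrite -(addn1 n) iotaD count_cat IHn /= add0n; lia.
Qed.

Lemma count_cells_row (Q : pred nat) i s : i < size s ->
  count (fun c => (c.1 == i) && Q c.2) (cells s) =
  count Q (iota 0 (nth 0 s i)).
Proof.
move=> i_s; rewrite /cells count_flatten -map_comp.
rewrite (eq_map (g := fun x => (x == i) * count Q (iota 0 (nth 0 s i)))); last first.
  move=> x /=; rewrite count_map; case: eqP => [->|ne] /=.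
    by rewrite mul1n; apply: eq_count => y /=; rewrite eqxx.
  by rewrite (eq_count (a2 := pred0)) ?count_pred0 // => y /=; case: eqP.
rewrite sumnE big_map -big_distrl /=.
rewrite (_ : \sum_(x <- _) _ = 1) ?mul1n //.
transitivity (count (pred1 i) (iota 0 (size s))).
  by rewrite -sum1_count [RHS]big_mkcond; apply: eq_bigr => x _ /=; case: eqP.
by rewrite count_iota_eq i_s.
Qed.

Lemma count_cells_col (Q : pred nat) j s :
  count (fun c => (c.2 == j) && Q c.1) (cells s) =
  count (fun i => Q i && (j < nth 0 s i)) (iota 0 (size s)).
Proof.
rewrite /cells count_flatten -map_comp sumnE big_map -sum1_count [RHS]big_mkcond.
apply: eq_bigr => i _ /=; rewrite count_map.
rewrite (eq_count (a2 := fun y => (y == j) && Q i)) //.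
case: (Q i) => /=; last by rewrite -[RHS](count_pred0 (iota 0 (nth 0 s i)));
  apply: eq_count => y; rewrite andbF.
rewrite (eq_count (a2 := pred1 j)) ?count_iota_eq => [|y /=]; last exact: andbT.
by case: (_ < _).
Qed.

Lemma mem_cells s v : (v \in cells s) = (v.2 < nth 0 s v.1).
Proof.
case: v => i j; apply/allpairsPdep/idP => /= [[x [y [xs ys [-> ->]]]]|j_lt].
  by move: ys; rewrite mem_iota.
exists i, j; rewrite !mem_iota; split=> //=; rewrite add0n.
by case: ltnP => // si; rewrite nth_default in j_lt.
Qed.

Lemma count_gtn_iota j n : count (ltn j) (iota 0 n) = n - j.+1.
Proof.
elim: n => // n IHn; rewrite -(addn1 n) iotaD count_cat IHn /= add0n; lia.
Qed.

Lemma count_between i k n :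
  count (fun x => (i < x) && (x < k)) (iota 0 n) = minn k n - i.+1.
Proof.
elim: n => [|n IHn]; first by rewrite minn0.
rewrite -(addn1 n) iotaD count_cat IHn /= add0n; lia.
Qed.

(** In a partition column [j] is an initial segment of the rows, which turns
    the four counts over cells into differences of a row or column length and
    a coordinate. *)
Lemma arm_leg_coarm s i j : sorted geq s -> (i, j) \in cells s ->
  [/\ arm s (i, j) = nth 0 s i - j.+1,
      leg s (i, j) = count (ltn j) s - i.+1,
      coarm s (i, j) = j & coleg s (i, j) = i].
Proof.
move=> s_sorted; rewrite mem_cells /= => jlt.
have ilt : i < size s by case: ltnP => // si; rewrite nth_default in jlt.
have iltc : i < count (ltn j) s by rewrite ltn_count_nth.
have cs : count (ltn j) s <= size s by apply: count_size.
have in_col x : (j < nth 0 s x) = (x < count (ltn j) s) by rewrite ltn_count_nth.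
split.
- by rewrite /arm (@count_cells_row (ltn j)) // count_gtn_iota.
- rewrite /leg (@count_cells_col (ltn i)) /=.
  under eq_count => x do rewrite in_col.
  by rewrite count_between (minn_idPl cs).
- rewrite /coarm (@count_cells_row (ltn^~ j)) // count_ltn_iota.
  by apply/minn_idPl/ltnW.
rewrite /coleg (@count_cells_col (ltn^~ i)) /=.
rewrite (eq_count (a2 := ltn^~ i)) ?count_ltn_iota; first by apply/minn_idPl/ltnW.
move=> x /=; rewrite in_col; case: ltnP => //= xi; exact: ltn_trans iltc.
Qed.

(** * Decomposition of a pointed partition *)

(** The image of the first step: the two rectangles are determined by [a], [l]
    and [m], hence left out. *)
Definition decomposed (a l m : nat) (A B C : seq nat) : bool :=
  [&& [&& is_part A, is_part B & is_part C],
      all (fun p => p <= m) A, fits l a B & all (ltn (m + a)) C].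

(** The [l] rows above the one of the cell extend beyond the first [m.+1]
    columns by the parts of [B], some of which may be zero. *)
Definition assemble (a l m : nat) (A B C : seq nat) : pointed :=
  (C ++ (m + a).+1 :: map (addn m.+1) (pad l B) ++ A, (size C, m)).

Section Assemble.

Variables (a l m : nat) (A B C : seq nat).
Hypothesis dec : decomposed a l m A B C.

Let rows := map (addn m.+1) (pad l B).
Let s := (assemble a l m A B C).1.

Let size_B : size B <= l.
Proof. by case/and4P: dec => _ _ /andP[]. Qed.

Let rows_gt : all (ltn m) rows.
Proof. by apply/allP=> _ /mapP[p _ ->] /=; rewrite addSn ltnS leq_addr. Qed.

(** The blocks lie in successive ranges, cut at [(m + a).+1] and [m.+1]. *)
Lemma assemble_part : is_part s.
Proof.
case/and4P: dec => /and3P[A_part B_part C_part] A_le /andP[_ B_le] C_gt.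
have rows_part : is_part rows.
  rewrite is_part_pairwise -(sorted_pairwise geq_trans) sorted_map_addn.
  rewrite sorted_pad //=; apply: sub_all rows_gt => p /=; exact: leq_ltn_trans.
have rows_le : all (geq (m + a).+1) rows.
  rewrite all_map; have := B_le; rewrite -(@all_pad _ l) //.
  by apply: sub_all => p /=; rewrite -addSn leq_add2l.
have A_le' : all (geq (m + a).+1) A.
  by apply: sub_all A_le => p /= pm; rewrite ltnW // ltnS (leq_trans pm) ?leq_addr.
rewrite /s /= -cat1s !is_part_cat C_part rows_part A_part !andbT.
rewrite (@allrel_geq (m + a).+1) ?C_gt //=; last first.
  by rewrite leqnn all_cat rows_le.
rewrite (@allrel_geq m.+1 rows) ?rows_gt //=; last first.
  by apply: sub_all A_le => p /= /leqW.
by rewrite (@allrel_geq (m + a).+1) ?all_cat ?rows_le //= leqnn.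
Qed.

Lemma assemble_cell : (size C, m) \in cells s.
Proof. by rewrite mem_cells nth_cat ltnn subnn /= ltnS leq_addr. Qed.

Lemma assemble_stats : 
  [/\ arm s (size C, m) = a, leg s (size C, m) = l,
      coarm s (size C, m) = m & coleg s (size C, m) = size C].
Proof.
have /andP[s_sorted _] := assemble_part.
have [-> -> -> ->] := arm_leg_coarm s_sorted assemble_cell.
split=> //; first by rewrite /s /= nth_cat ltnn subnn /= -addSn addKn.
case/and4P: dec => _ A_le _ C_gt.
rewrite /s /= count_cat /= count_cat.
have -> : count (ltn m) C = size C.
  apply/eqP; rewrite -all_count; apply: sub_all C_gt => p /=.
  by apply: leq_ltn_trans; exact: leq_addr.
have -> : count (ltn m) rows = l.
  by move: rows_gt; rewrite all_count => /eqP->; rewrite size_map size_pad.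
have -> : count (ltn m) A = 0.
  apply/eqP; rewrite -leqn0 leqNgt -has_count; apply/hasPn => p.
  by move/allP: A_le => /[apply]; rewrite /= -leqNgt.
rewrite /= ltnS leq_addr; lia.
Qed.

Lemma phi_assemble :
  phi a l m (assemble a l m A B C) = (A, B, C, rect l.+1 m.+1, rect 1 a).
Proof.
have [_ _ _ gE] := assemble_stats.
have size_rows : size rows = l by rewrite size_map size_pad.
rewrite /phi /assemble -/rows -/s gE /s /= -/rows.
have take_C r : take (size C) (C ++ r) = C by rewrite take_size_cat.
have drop_C k r : drop (size C + k) (C ++ r) = drop k r.
  by rewrite addnC -drop_drop drop_size_cat.
rewrite take_C -addnA drop_C -(addn1 (size C)) drop_C addn1 /= drop0.
rewrite -size_rows drop_size_cat // take_size_cat //.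
case/and4P: dec => /and3P[_ B_part _] _ _ _.
by rewrite (map_addn_subnK m.+1) size_rows del0_pad.
Qed.

Lemma sumn_assemble :
  sumn s = sumn A + sumn B + sumn C
         + sumn (rect l.+1 m.+1) + sumn (rect 1 a).
Proof.
have -> : s = C ++ [:: (m + a).+1] ++ rows ++ A by [].
rewrite !sumn_cat /rows sumn_map_addn sumn_pad size_pad //.
have -> : sumn (rect l.+1 m.+1) = m.+1 * l.+1 by exact: sumn_nseq.
have -> : sumn (rect 1 a) = a by case: (a) => //= k; rewrite addn0.
rewrite (_ : sumn [:: _] = (m + a).+1); first by lia.
exact: addn0.
Qed.

End Assemble.

(** The rows above the cell that still reach its column are exactly those of
    index less than the length of that column, so cutting there leaves parts
    larger than [j] below and parts at most [j] above. *)
Lemma phi_decomposed s i j (l := leg s (i, j)) (a := arm s (i, j)) :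
  is_part s -> (i, j) \in cells s ->
  exists A B C, [/\ decomposed a l j A B C, assemble a l j A B C = (s, (i, j))
                 & phi a l j (s, (i, j)) = (A, B, C, rect l.+1 j.+1, rect 1 a)].
Proof.
move=> s_part s_cell; have /andP[s_sorted _] := s_part.
have := arm_leg_coarm s_sorted s_cell; rewrite -/a -/l => -[aE lE _ gE].
move: s_cell; rewrite mem_cells /= => jlt.
have ilt : i < size s by case: ltnP => // si; rewrite nth_default in jlt.
have iltc : i < count (ltn j) s by rewrite ltn_count_nth.
set k := count (ltn j) s in iltc lE.
pose C := take i s; pose A := drop k s; pose R := take l (drop i.+1 s).
pose B := del0 (map (subn^~ j.+1) R).
have size_C : size C = i by rewrite size_takel // ltnW.
have ks : k <= size s by apply: count_size.
have size_R : size R = l by rewrite size_takel // size_drop lE; lia.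
have sE : s = C ++ (j + a).+1 :: R ++ A.
  rewrite -[LHS](cat_take_drop i) (drop_nth 0) //; congr (_ ++ _ :: _); first by lia.
  rewrite -[LHS](cat_take_drop l) drop_drop; congr (_ ++ drop _ s).
  by lia.
have : is_part (C ++ (j + a).+1 :: R ++ A) by rewrite -sE.
rewrite -cat1s !is_part_cat.
case/and5P=> /allrelP C_ge C_part /allrelP R_le _ /and3P[_ R_part A_part].
have R_gt : all (leq j.+1) R.
  apply/allP=> p /= pR; have : p \in take k s.
    have -> : k = i.+1 + l by lia.
    by rewrite takeD mem_cat pR orbT.
  by rewrite take_count // mem_filter => /andP[].
have subR_sorted : sorted geq (map (subn^~ j.+1) R).
  rewrite -(sorted_map_addn j.+1) map_subn_addnK //.
  by case/andP: R_part.
have B_pad : map (addn j.+1) (pad l B) = R.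
  by rewrite -size_R -(size_map (subn^~ j.+1) R) pad_del0 // map_subn_addnK.
have dec : decomposed a l j A B C.
  rewrite /decomposed A_part del0_sorted // C_part /=; apply/and3P; split.
  - by rewrite /A drop_count //; exact: filter_all.
  - rewrite /fits size_filter -[l]size_R -(size_map (subn^~ j.+1) R) count_size /=.
    apply/allP => p; rewrite mem_filter => /andP[_ /mapP[q qR ->]].
    have := R_le (j + a).+1 q; rewrite inE eqxx mem_cat qR /= => /(_ isT isT); lia.
  - by apply/allP => p pC; apply: C_ge => //; rewrite mem_head.
exists A, B, C; split=> //.
  by rewrite /assemble B_pad -sE size_C.
by have := phi_assemble dec; rewrite /assemble B_pad -sE size_C.
Qed.

(** * Inverting the pealing algorithm *)

(** The deleted part is [r - a]. The parts below it are those that lost a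
    cell; there were [a] of them, counting the ones that vanished. *)
Definition unpeal_step (a r : nat) (s : seq nat) : seq nat :=
  [seq p <- s | r - a <= p]
    ++ (r - a) :: map succn (pad a [seq p <- s | p < r - a]).

Lemma is_part_unpeal a r s : is_part s -> a < r -> is_part (unpeal_step a r s).
Proof.
move=> s_part ar; rewrite /unpeal_step; set big := filter _ _.
set small := filter _ _.
have small_part : is_part (map succn (pad a small)).
  apply/andP; split; last by apply/mapP => -[].
  by rewrite (sorted_map_addn 1) sorted_pad // is_part_filter.
have small_le : all (geq (r - a)) (map succn (pad a small)).
  by rewrite all_map all_pad /= ?subn_gt0 // filter_all.
have big_ge : all (leq (r - a)) big by apply: filter_all.
rewrite -cat1s !is_part_cat is_part_filter // small_part.
rewrite (@allrel_geq (r - a) big) //=; last by rewrite leqnn.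
rewrite (@allrel_geq (r - a)) //= ?leqnn // andbT.
by rewrite /is_part /= inE eq_sym -lt0n subn_gt0.
Qed.

Lemma sumn_split (P : pred nat) s :
  sumn [seq p <- s | P p] + sumn [seq p <- s | ~~ P p] = sumn s.
Proof. by elim: s => //= p s IHs; case: (P p) => /=; lia. Qed.

Lemma filter_ltnNge c s : [seq p <- s | p < c] = [seq p <- s | ~~ (c <= p)].
Proof. by apply: eq_filter => p; rewrite ltnNge. Qed.

Lemma sumn_unpeal a r s : a < r -> count (ltn^~ (r - a)) s <= a ->
  sumn (unpeal_step a r s) = sumn s + r.
Proof.
move=> ar few; rewrite /unpeal_step sumn_cat /= (sumn_map_addn 1).
rewrite sumn_pad size_pad ?size_filter // -(sumn_split (leq (r - a)) s).
by rewrite filter_ltnNge; lia.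
Qed.

Lemma all_unpeal a m r s : a < r -> r <= a + m ->
  all (fun p => p <= m) s -> all (fun p => p <= m) (unpeal_step a r s).
Proof.
move=> ar rm s_le; rewrite all_cat /= all_map all_pad /=; last by lia.
apply/and3P; split; last by apply/allP => p; rewrite mem_filter /=; lia.
  by apply/allP => p; rewrite mem_filter => /andP[_] /(allP s_le).
by lia.
Qed.

(** The condition on [count] leaves room for the small parts among the last [a]
    parts, so that the inserted part is the one that pealing removes. *)
Lemma unpeal_stepK a r s : is_part s -> a < r -> count (ltn^~ (r - a)) s <= a ->
  [/\ a < size (unpeal_step a r s), peal_step a (unpeal_step a r s) = s
    & rim_hook_length a (unpeal_step a r s) = r].
Proof.
move=> s_part ar few; have /andP[s_sorted _] := s_part.
rewrite /peal_step /rim_hook_length /unpeal_step.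
set big := filter _ _; set small := filter _ _.
set tail := map succn (pad a small).
have size_tail : size tail = a by rewrite size_map size_pad // size_filter.
have sizeE : size (big ++ (r - a) :: tail) = size big + a.+1.
  by rewrite size_cat /= size_tail.
rewrite sizeE addnK take_size_cat // nth_cat ltnn subnn /=.
split; [by lia | | by rewrite subnK // ltnW].
rewrite (_ : size big + a.+1 - a = (size big).+1); last by lia.
rewrite -cat_rcons drop_size_cat ?size_rcons // -map_comp map_id.
(* [filter_split] keeps the parts above its argument, and [r - a] is positive. *)
rewrite del0_pad ?is_part_filter // -[RHS](filter_split (r - a).-1 s_sorted).
by congr cat; apply: eq_filter => p; lia.
Qed.

Lemma peal_split a s : is_part s -> a < size s ->
  exists s1 p s2, [/\ s = s1 ++ p :: s2, size s2 = a,
    all (leq p) s1, all (geq p) s2 & 0 < p].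
Proof.
move=> s_part a_lt; pose k := size s - a.+1.
have kP : k < size s by rewrite /k; lia.
have sE : s = take k s ++ nth 0 s k :: drop k.+1 s.
  by rewrite -drop_nth // cat_take_drop.
exists (take k s), (nth 0 s k), (drop k.+1 s).
have : is_part (take k s ++ [:: nth 0 s k] ++ drop k.+1 s) by rewrite /= -sE.
rewrite !is_part_cat => /and5P[/allrelP ge _ /allrelP le].
rewrite is_part_pairwise /= => /andP[p_gt0 _] _.
split=> //; first by rewrite size_drop /k; lia.
- by apply/allP => x xs; apply: ge => //; rewrite mem_head.
- by apply/allP => x xs; apply: le => //; rewrite inE eqxx.
Qed.

(** After the removal of [p], the parts before [p] are at least [p] and those
    after it have dropped below [p], so comparison with [p] tells which parts
    lost a cell. *)
Lemma peal_stepK a s : is_part s -> a < size s ->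
  [/\ unpeal_step a (rim_hook_length a s) (peal_step a s) = s,
      is_part (peal_step a s), a < rim_hook_length a s
    & count (ltn^~ (rim_hook_length a s - a)) (peal_step a s) <= a].
Proof.
move=> s_part a_lt.
have [s1 [p [s2 [sE size_s2 s1_ge s2_le p_gt0]]]] := peal_split s_part a_lt.
have [s1_part s2_part] : is_part s1 /\ is_part s2.
  by move: s_part; rewrite sE -cat1s !is_part_cat => /and5P[].
have r_eq : rim_hook_length a s = p + a.
  rewrite /rim_hook_length sE size_cat /= size_s2 addnK.
  by rewrite nth_cat ltnn subnn.
have s2_gt : all (leq 1) s2 by move: s2_part; rewrite is_part_pairwise => /andP[].
have step_eq : peal_step a s = s1 ++ del0 (map predn s2).
  rewrite /peal_step sE size_cat /= size_s2 addnK take_size_cat //.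
  rewrite (_ : size s1 + a.+1 - a = (size s1).+1); last by lia.
  by rewrite -cat_rcons drop_size_cat // size_rcons.
have pred_s2 : map succn (map predn s2) = s2.
  rewrite -map_comp map_id_in // => q /(allP s2_gt) /=; exact: prednK.
have pred_sorted : sorted geq (map predn s2).
  by rewrite -(sorted_map_addn 1) pred_s2; case/andP: s2_part.
have t_lt : all (fun q => q < p) (del0 (map predn s2)).
  apply/allP => _ /[!mem_filter] /andP[_ /mapP[q q_s2 ->]].
  by have /= := allP s2_le q q_s2; have /= := allP s2_gt q q_s2; lia.
rewrite r_eq addnK step_eq; set t := del0 _ in t_lt *.
have s1_big : [seq q <- s1 | p <= q] = s1 by apply/all_filterP.
have s1_small : [seq q <- s1 | q < p] = [::].
  by apply: filter_none => q /(allP s1_ge); rewrite /= leqNgt.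
have t_big : [seq q <- t | p <= q] = [::].
  by apply: filter_none => q /(allP t_lt); rewrite ltnNge.
have t_small : [seq q <- t | q < p] = t by apply/all_filterP.
split.
- rewrite /unpeal_step addnK !filter_cat s1_big s1_small t_big t_small cats0 /=.
  by rewrite -size_s2 -(size_map predn s2) pad_del0 // pred_s2 sE.
- rewrite is_part_cat s1_part del0_sorted // andbT andbT.
  by apply: (allrel_geq s1_ge); apply: sub_all t_lt => q /= /ltnW.
- by rewrite -addn1 addnC leq_add2r.
rewrite -size_filter filter_cat s1_small t_small /= size_filter.
by rewrite -size_s2 -(size_map predn) count_size.
Qed.

(** The part removed is followed by [a] parts that are no larger, so if it were
    below [c], more than [a] parts would be. With [peal_stepK], this shows that the lengths of
    successive hooks weakly increase. *)
Lemma rim_hook_length_ge a c s : is_part s -> a < size s ->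
  count (ltn^~ c) s <= a -> c + a <= rim_hook_length a s.
Proof.
move=> s_part a_lt; rewrite leqNgt => few; rewrite leqNgt.
apply: contra few.
have [s1 [p [s2 [sE size_s2 _ s2_le _]]]] := peal_split s_part a_lt.
have -> : rim_hook_length a s = p + a.
  rewrite /rim_hook_length sE size_cat /= size_s2 addnK.
  by rewrite nth_cat ltnn subnn.
rewrite ltn_add2r => pc; rewrite sE count_cat /= pc -size_s2.
suff -> : count (ltn^~ c) s2 = size s2 by lia.
apply/eqP; rewrite -all_count; apply: sub_all s2_le => q /= qp.
exact: leq_ltn_trans qp pc.
Qed.

(** The inserted part [r - a] and those before it are at least [r' - a]; only
    the last [a] parts may be smaller. This is why hooks can be inserted one
    after the other when their lengths decrease. *)
Lemma count_unpeal a r r' s : r' <= r -> count (ltn^~ (r - a)) s <= a ->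
  count (ltn^~ (r' - a)) (unpeal_step a r s) <= a.
Proof.
move=> r'r few; rewrite /unpeal_step count_cat /=.
rewrite (_ : (r - a < r' - a) = false) ?add0n; last by lia.
rewrite -size_filter -filter_predI (eq_filter (a2 := pred0)) ?filter_pred0.
  apply: leq_trans (count_size _ _) _.
  by rewrite size_map size_pad // size_filter.
by move=> q /=; lia.
Qed.

(** The head of [rs] is the hook removed first, hence the one inserted last. *)
Definition unpeal (a : nat) (rs s : seq nat) : seq nat :=
  foldr (unpeal_step a) s rs.

Definition pealed (a : nat) (rs s : seq nat) :=
  [&& is_part s, size s <= a, sorted leq rs & all (ltn a) rs].

(** The induction also carries the condition under which one more hook, no
    longer than the previous ones, can be inserted. *)
Lemma unpealK a rs s : pealed a rs s ->
  [/\ peal a (unpeal a rs s) = (s, rs), is_part (unpeal a rs s)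
    & sumn (unpeal a rs s) = sumn s + sumn rs].
Proof.
case/and4P=> s_part s_small rs_sorted rs_gt.
suff [peal_eq u_part u_sum _] :
  [/\ peal a (unpeal a rs s) = (s, rs), is_part (unpeal a rs s),
      sumn (unpeal a rs s) = sumn s + sumn rs
    & forall r, all (leq r) rs -> count (ltn^~ (r - a)) (unpeal a rs s) <= a].
  by split.
elim: rs rs_sorted rs_gt => [|r rs IHrs] /= rs_sorted => [_|/andP[ar rs_gt]].
  split=> //; last by move=> r _; apply: leq_trans (count_size _ _) s_small.
    by rewrite pealE ltnNge s_small.
  by rewrite addn0.
have [peal_eq u_part u_sum u_few] := IHrs (path_sorted rs_sorted) rs_gt.
have few := u_few r (order_path_min leq_trans rs_sorted).
have [a_lt step_eq r_eq] := unpeal_stepK u_part ar few.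
split.
- by rewrite pealE a_lt step_eq r_eq peal_eq.
- exact: is_part_unpeal.
- by rewrite sumn_unpeal // u_sum; lia.
by move=> r' /andP[r'r _]; apply: count_unpeal.
Qed.

Lemma all_unpeals a m rs s : all (ltn a) rs -> all (fun r => r <= a + m) rs ->
  all (fun p => p <= m) s -> all (fun p => p <= m) (unpeal a rs s).
Proof.
move=> + + s_le; elim: rs => //= r rs IHrs /andP[ar rs_gt] /andP[rm rs_le].
by apply: all_unpeal => //; apply: IHrs.
Qed.

(** The bound [a + m] on the lengths is what later separates the hooks from the
    parts of [C]. *)
Lemma pealK a m s : is_part s -> all (fun p => p <= m) s ->
  let: (s', rs) := peal a s in
  [/\ pealed a rs s', unpeal a rs s' = s, all (fun p => p <= m) s'
    & all (fun r => r <= a + m) rs].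
Proof.
have [k] := ubnP (size s); elim: k s => // k IHk s size_s s_part s_le.
rewrite pealE; case: ifP => a_lt; last first.
  by split=> //; rewrite /pealed s_part leqNgt a_lt.
have [unstep step_part ar few] := peal_stepK s_part a_lt.
have step_le : all (fun p => p <= m) (peal_step a s).
  rewrite all_cat; apply/andP; split.
    by apply/allP => p /mem_take /(allP s_le).
  apply/allP => _ /[!mem_filter] /andP[_ /mapP[q /mem_drop /(allP s_le) qm ->]].
  exact: leq_trans (leq_pred q) qm.
have := IHk _ (leq_trans (size_peal_step a_lt) size_s) step_part step_le.
set r := rim_hook_length a s in unstep ar few *.
case Epeal: (peal a (peal_step a s)) => [s' rs] [rs_pealed un_rs s'_le rs_le].
have /and4P[s'_part s'_small rs_sorted rs_gt] := rs_pealed.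
have r_le : r <= a + m.
  rewrite /r /rim_hook_length addnC leq_add2l; apply: (allP s_le).
  by rewrite mem_nth // ltn_subrL (leq_ltn_trans _ a_lt).
split=> //=; rewrite ?un_rs ?r_le //.
rewrite /pealed s'_part s'_small /= ar rs_gt andbT.
case: rs Epeal rs_sorted {rs_pealed un_rs rs_gt rs_le} => //= r' rs + ->.
rewrite andbT pealE; case: ifP => // a_lt'; case: (peal a _) => _ _ [_ <- _].
have := rim_hook_length_ge step_part a_lt' few.
by rewrite subnK ?andbT // ltnW.
Qed.

(** * The bijection and the involution *)

(** In [Ct], the parts above [m + a] come from below the row of the cell and
    the other ones are the lengths of hooks, the last removed first. *)
Definition Psi_inverse (y : tagged_quintuple) : pointed :=
  let: (a, l, m, (At, B, Ct, _, _)) := y in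
  assemble a l m (unpeal a (rev [seq r <- Ct | r <= a + m]) At) B
           [seq r <- Ct | m + a < r].

Lemma in_Qtilde n a l m A B C D E :
  ((a, l, m, (A, B, C, D, E)) \in Qtilde n) =
  [&& [&& is_part A, is_part B & is_part C],
      fits a m A, fits l a B, all (fun p => a.+1 <= p) C,
      D == rect l.+1 m.+1, E == rect 1 a
    & sumn A + sumn B + sumn C + sumn D + sumn E == n].
Proof. by []. Qed.

(** By [unpealK], unpealing followed by pealing returns the hooks and the box;
    the split of [Ct] at [m + a] is undone by concatenation. *)
Lemma Psi_inverse_spec n y : y \in Qtilde n ->
  Psi_inverse y \in F n /\ Psi (Psi_inverse y) = y.
Proof.
case: y => [[[a l] m] [[[[At B] Ct] D] E]].
rewrite in_Qtilde => /and5P[/and3P[At_part B_part Ct_part] At_fits B_fits Ct_gt].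
case/and3P=> /eqP-> /eqP-> /eqP sum_n.
have /andP[Ct_sorted _] := Ct_part.
set C := [seq r <- Ct | m + a < r]; set R := [seq r <- Ct | r <= a + m].
have CtE : C ++ R = Ct by rewrite /C /R [a + m]addnC filter_split.
have R_pealed : pealed a (rev R) At.
  rewrite /pealed At_part rev_sorted sorted_filter //=; last exact: geq_trans.
  case/andP: At_fits => -> _ /=; rewrite all_rev.
  by apply/allP=> r /[!mem_filter] /andP[_ /(allP Ct_gt)].
have [peal_eq A_part sum_A] := unpealK R_pealed.
have A_le : all (fun p => p <= m) (unpeal a (rev R) At).
  apply: all_unpeals; first by case/and4P: R_pealed.
    by rewrite all_rev filter_all.
  by case/andP: At_fits.
have dec : decomposed a l m (unpeal a (rev R) At) B C.
  by rewrite /decomposed A_part B_part A_le B_fits is_part_filter // filter_all.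
have [aE lE mE _] := assemble_stats dec.
split.
  rewrite unfold_in /= assemble_part // assemble_cell andbT /=.
  have -> := sumn_assemble dec.
  rewrite sum_A sumn_rev -sum_n -[in sumn Ct]CtE sumn_cat.
  move: (sumn (rect _ _)) (sumn (rect 1 a)) => d e; apply/eqP; clear; lia.
by rewrite /Psi aE lE mE phi_assemble //= peal_eq revK CtE.
Qed.

(** Hook lengths are at most [a + j] and the parts of [C] exceed it, hence
    [C ++ rev rs] is a partition from which both can be recovered. *)
Lemma Psi_spec n x : x \in F n -> Psi x \in Qtilde n /\ Psi_inverse (Psi x) = x.
Proof.
case: x => s [i j] xF.
have [s_part sum_n s_cell] : [/\ is_part s, sumn s = n & (i, j) \in cells s].
  by case/and3P: xF => ? /eqP.
have [A [B [C [dec asm_eq phi_eq]]]] := phi_decomposed s_part s_cell.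
have /andP[s_sorted _] := s_part.
have [_ _ jE _] := arm_leg_coarm s_sorted s_cell.
have := sumn_assemble dec; rewrite asm_eq [_.1]/= sum_n => sumE.
move: dec asm_eq phi_eq sumE; set a := arm s _; set l := leg s _.
move=> dec asm_eq phi_eq sumE.
have -> : Psi (s, (i, j)) =
    (a, l, j, psi a (A, B, C, rect l.+1 j.+1, rect 1 a)).
  by rewrite -phi_eq /Psi jE.
have /and4P[/and3P[A_part B_part C_part] A_le B_fits C_gt] := dec.
rewrite /psi; have := @pealK a j A A_part A_le.
case: (peal a A) => At rs [At_pealed unE At_le rs_le].
have [_ _ sum_A] := unpealK At_pealed; rewrite unE in sum_A.
have /and4P[At_part At_size rs_sorted rs_gt] := At_pealed.
have rs_part : is_part (rev rs).
  rewrite is_part_pairwise -(sorted_pairwise geq_trans) rev_sorted rs_sorted.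
  by rewrite all_rev; apply: sub_all rs_gt => r /=; apply: leq_ltn_trans.
split.
  rewrite in_Qtilde At_part B_part is_part_cat C_part rs_part B_fits !eqxx.
  rewrite /fits At_size At_le all_cat all_rev rs_gt !andbT !andTb.
  apply/and3P; split.
  - apply: (@allrel_geq (a + j)); last by rewrite all_rev.
    by apply: sub_all C_gt => r /= /ltnW; rewrite addnC.
  - by apply: sub_all C_gt => r /=; apply: leq_ltn_trans; exact: leq_addl.
  rewrite sumE sum_A sumn_cat sumn_rev; apply/eqP.
  move: (sumn (rect _ _)) (sumn (rect 1 a)) => d e; clear; lia.
have C_filter : [seq r <- C ++ rev rs | j + a < r] = C.
  rewrite filter_cat (all_filterP C_gt) -[RHS]cats0; congr cat.
  apply: filter_none => r; rewrite mem_rev.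
  by move/(allP rs_le); rewrite -leqNgt addnC.
have rs_filter : [seq r <- C ++ rev rs | r <= a + j] = rev rs.
  rewrite filter_cat filter_rev (all_filterP rs_le) -[RHS]cat0s; congr cat.
  apply: filter_none => r.
  by move/(allP C_gt); rewrite -ltnNge addnC.
by rewrite /= C_filter rs_filter revK unE.
Qed.

Lemma rho_spec n y : y \in Qtilde n -> rho y \in Qtilde n /\ rho (rho y) = y.
Proof.
case: y => [[[a l] m] [[[[A B] C] D] E]].
rewrite in_Qtilde => /and5P[/and3P[A_part B_part C_part] A_fits B_fits C_gt].
case/and3P=> /eqP-> /eqP-> /eqP <-.
have /andP[A_sorted _] := A_part; have /andP[B_sorted _] := B_part.
have rhoE l' m' A' B' :
    rho (a, l', m', (A', B', C, rect l'.+1 m'.+1, rect 1 a)) =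
    (a, m', l', (conj_part B', conj_part A', C, rect m'.+1 l'.+1, rect 1 a)).
  by rewrite -(conj_rect l' m').
rewrite !rhoE !conj_partK //; split=> //.
rewrite in_Qtilde !conj_part_is_part // C_part !fits_conj_part // C_gt !eqxx !andTb.
rewrite !sumn_conj_part //.
have rectE r c : sumn (rect r.+1 c.+1) = c.+1 * r.+1 by exact: sumn_nseq.
by rewrite (rectE m l) (rectE l m) mulnC [sumn B + _]addnC.
Qed.

Lemma rho_tag a l m q : (rho (a, l, m, q)).1 = (a, m, l).
Proof. by case: q => -[[[A B] C] D] E. Qed.

Theorem theorem2 (n : nat) :
  exists Psi_inv : tagged_quintuple -> pointed,
    [/\ {in F n, forall x, Psi x \in Qtilde n},
        {in Qtilde n, forall y, Psi_inv y \in F n},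
        {in F n, cancel Psi Psi_inv},
        {in Qtilde n, cancel Psi_inv Psi}
      & let Phi := Psi_inv \o rho \o Psi in
        [/\ {in F n, forall x, Phi x \in F n},
            {in F n, involutive Phi}
          & forall (la : seq nat) (v : nat * nat) (mu : seq nat) (u : nat * nat),
              (la, v) \in F n -> Phi (la, v) = (mu, u) ->
              (arm la v, leg la v, coarm la v) = (arm mu u, coarm mu u, leg mu u)
              /\ (hook la v, part_length la v) = (part_length mu u, hook mu u)]].
Proof.
exists Psi_inverse.
have PsiQ x (xF : x \in F n) : Psi x \in Qtilde n by have [] := Psi_spec xF.
have PsiK x (xF : x \in F n) : Psi_inverse (Psi x) = x by have [] := Psi_spec xF.
have invF y (yQ : y \in Qtilde n) : Psi_inverse y \in F n.
  by have [] := Psi_inverse_spec yQ.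
have invK y (yQ : y \in Qtilde n) : Psi (Psi_inverse y) = y.
  by have [] := Psi_inverse_spec yQ.
have rhoQ y (yQ : y \in Qtilde n) : rho y \in Qtilde n by have [] := rho_spec yQ.
split=> // Phi.
have PhiE x : Phi x = Psi_inverse (rho (Psi x)) by [].
split=> [x xF|x xF|la v mu u vF Phi_v].
- by rewrite invF ?rhoQ ?PsiQ.
- have [_ rhoK] := rho_spec (PsiQ x xF).
  by rewrite PhiE invK ?rhoQ ?PsiQ // rhoK PsiK.
have [arm_eq leg_eq coarm_eq] :
  [/\ arm mu u = arm la v, leg mu u = coarm la v & coarm mu u = leg la v].
  have : Psi (mu, u) = rho (Psi (la, v)) by rewrite -Phi_v PhiE invK ?rhoQ ?PsiQ.
  by move/(congr1 fst); rewrite rho_tag => -[-> -> ->].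
by rewrite /hook /part_length arm_eq leg_eq coarm_eq.
Qed.
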